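(* Let $\mathfrak{h}$ be one of the three-dimensional real Lie algebras $\mathfrak{h}_1$, $\mathfrak{r}_{3,-1}$, $\mathfrak{r}_{3,0}'$ or $\mathfrak{r}_{3,0}\cong\mathbb{R}\times\mathfrak{aff}(\mathbb{R})$, and let $T^*\mathfrak{h}=\mathfrak{h}\ltimes\mathfrak{h}^*$ be its cotangent Lie algebra. Then totally real complex structures on $T^*\mathfrak{h}$ exist. In these cases the linear map $j:\mathfrak{h}\to\mathfrak{h}^*$ determining a totally real complex structure is represented, with respect to the bases $e_1,e_2,e_3$ of $\mathfrak{h}$ and $e_4=e^1,\ e_5=e^2,\ e_6=e^3$ (dual basis) of $\mathfrak{h}^*$ (the $k$-th column being the coordinates of $je_k$), by a non-singular real matrix of the following form: $$T^*\mathfrak{h}_1:\ \begin{pmatrix} a_{41}&a_{42}&a_{43}\\ a_{51}&a_{52}&a_{53}\\ -a_{43}&-a_{53}&0\end{pmatrix};\qquad T^*\mathfrak{r}_{3,-1}:\ \begin{pmatrix} a_{41}&a_{42}&a_{43}\\ -a_{42}&0&a_{53}\\ -a_{43}&-a_{53}&0\end{pmatrix};$$ $$T^*\mathfrak{r}_{3,0}:\ \begin{pmatrix} a_{41}&a_{42}&a_{43}\\ -a_{42}&0&0\\ a_{61}&0&a_{63}\end{pmatrix};\qquad T^*\mathfrak{r}_{3,0}':\ \begin{pmatrix} a_{41}&a_{42}&a_{43}\\ -a_{42}&0&a_{53}\\ -a_{43}&-a_{53}&0\end{pmatrix}.$$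
   Context: The Lie algebras have basis $e_1,e_2,e_3$ and non-zero brackets: $\mathfrak{h}_1$: $[e_1,e_2]=e_3$; $\mathfrak{r}_{3,-1}$: $[e_1,e_2]=e_2$, $[e_1,e_3]=-e_3$; $\mathfrak{r}_{3,0}$: $[e_1,e_2]=e_2$; $\mathfrak{r}_{3,0}'$: $[e_1,e_2]=-e_3$, $[e_1,e_3]=e_2$. The cotangent Lie algebra $T^*\mathfrak{h}$ is the vector space $\mathfrak{h}\oplus\mathfrak{h}^*$ with bracket $[(x,\varphi),(x',\varphi')]=([x,x'],\mathrm{ad}^*(x)\varphi'-\mathrm{ad}^*(x')\varphi)$, where $(\mathrm{ad}^*(x)\varphi)(y)=-\varphi([x,y])$. A complex structure on a real Lie algebra $\mathfrak{g}$ is a linear map $J$ with $J^2=-\mathrm{I}$ and $[Jx,Jy]-[x,y]-J[Jx,y]-J[x,Jy]=0$ for all $x,y\in\mathfrak{g}$. It is totally real on $T^*\mathfrak{h}$ if $J\mathfrak{h}=\mathfrak{h}^*$; then $J(x,\varphi)=(-j^{-1}\varphi,jx)$ for a linear isomorphism $j:\mathfrak{h}\to\mathfrak{h}^*$. *)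

(* Defs.v *)
From HB Require Import structures.
From mathcomp Require Import all_boot all_order all_algebra.
From mathcomp Require Import ring.

Set Implicit Arguments.
Unset Strict Implicit.
Unset Printing Implicit Defensive.

Import GRing.Theory.
Local Open Scope ring_scope.

HB.mixin Record isLie (R : fieldType) (V : Type) of Vector R V := {
  lie : V -> V -> V;
  lieDl : forall x y z, lie (x + y) z = lie x z + lie y z;
  lieDr : forall x y z, lie x (y + z) = lie x y + lie x z;
  lieZl : forall (a : R) x y, lie (a *: x) y = a *: lie x y;
  lieZr : forall (a : R) x y, lie x (a *: y) = a *: lie x y;
  liexx : forall x, lie x x = 0;
  lie_jacobi : forall x y z,
    lie x (lie y z) + lie y (lie z x) + lie z (lie x y) = 0
}.

#[short(type="lieAlgType")]
HB.structure Definition LieAlgebra (R : fieldType) :=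
  { V of isLie R V & Vector R V }.

Section LieTheory.
Variables (R : fieldType) (h : lieAlgType R).
Implicit Types x y z : h.

Lemma lieC x y : lie x y = - lie y x.
Proof.
apply/eqP; rewrite -addr_eq0; apply/eqP.
by have := liexx (x + y); rewrite lieDl !lieDr !liexx add0r addr0.
Qed.

Lemma lieNr x y : lie x (- y) = - lie x y.
Proof. by rewrite -scaleN1r lieZr scaleN1r. Qed.

Lemma lie_der x y z : lie (lie x y) z = lie x (lie y z) - lie y (lie x z).
Proof.
have := lie_jacobi x y z; rewrite (lieC z (lie x y)) (lieC z x) lieNr.
by move/eqP; rewrite subr_eq0 => /eqP.
Qed.

End LieTheory.

Section Cotangent.
Variables (R : fieldType) (h : lieAlgType R).

Definition coad_form (x : h) (phi : 'Hom(h, R^o)) (y : h) : R^o :=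
  - phi (lie x y).

Fact coad_form_linear x phi : linear (coad_form x phi).
Proof.
by move=> a y z; rewrite /coad_form lieDr lieZr linearP opprD scalerN.
Qed.
HB.instance Definition _ x phi :=
  GRing.isLinear.Build R h R^o _ (coad_form x phi) (coad_form_linear x phi).

Definition coad (x : h) (phi : 'Hom(h, R^o)) : 'Hom(h, R^o) :=
  linfun (coad_form x phi).

Lemma coadE x phi y : coad x phi y = - phi (lie x y).
Proof. by rewrite lfunE. Qed.

Definition cotangent : Type := (h * 'Hom(h, R^o))%type.

HB.instance Definition _ := Vector.on cotangent.

Definition cotangent_lie (u v : cotangent) : cotangent :=
  (lie u.1 v.1, coad u.1 v.2 - coad v.1 u.2).

Lemma coadDl x y p : coad (x + y) p = coad x p + coad y p.
Proof.
by apply/lfunP => z; rewrite add_lfunE !coadE lieDl linearD opprD.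
Qed.
Lemma coadDr x p q : coad x (p + q) = coad x p + coad x q.
Proof. by apply/lfunP => z; rewrite add_lfunE !coadE add_lfunE opprD. Qed.
Lemma coadZl a x p : coad (a *: x) p = a *: coad x p.
Proof.
by apply/lfunP => z; rewrite scale_lfunE !coadE lieZl linearZ scalerN.
Qed.
Lemma coadZr a x p : coad x (a *: p) = a *: coad x p.
Proof. by apply/lfunP => z; rewrite scale_lfunE !coadE scale_lfunE scalerN. Qed.
Lemma coadBr x p q : coad x (p - q) = coad x p - coad x q.
Proof. by rewrite coadDr -scaleN1r coadZr scaleN1r. Qed.
Lemma coad_lie x y p : coad (lie x y) p = coad x (coad y p) - coad y (coad x p).
Proof.
apply/lfunP => z; rewrite add_lfunE opp_lfunE !coadE !opprK lie_der linearB.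
by rewrite opprB addrC.
Qed.

Fact cotangent_lieDl u v w :
  cotangent_lie (u + v) w = cotangent_lie u w + cotangent_lie v w.
Proof.
congr pair; first exact: lieDl.
by rewrite /= coadDl coadDr opprD addrACA.
Qed.
Fact cotangent_lieDr u v w :
  cotangent_lie u (v + w) = cotangent_lie u v + cotangent_lie u w.
Proof.
congr pair; first exact: lieDr.
by rewrite /= coadDl coadDr opprD addrACA.
Qed.
Fact cotangent_lieZl (a : R) u v :
  cotangent_lie (a *: u) v = a *: cotangent_lie u v.
Proof.
congr pair; first exact: lieZl.
by rewrite /= coadZl coadZr scalerBr.
Qed.
Fact cotangent_lieZr (a : R) u v :
  cotangent_lie u (a *: v) = a *: cotangent_lie u v.
Proof.
congr pair; first exact: lieZr.
by rewrite /= coadZl coadZr scalerBr.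
Qed.
Fact cotangent_liexx u : cotangent_lie u u = 0.
Proof. by congr pair; rewrite ?liexx ?subrr. Qed.
Fact cotangent_lie_jacobi u v w :
  cotangent_lie u (cotangent_lie v w) + cotangent_lie v (cotangent_lie w u)
  + cotangent_lie w (cotangent_lie u v) = 0.
Proof.
congr pair; first exact: lie_jacobi.
rewrite /= !coad_lie !coadBr.
apply/lfunP => z; rewrite !(add_lfunE, opp_lfunE, zero_lfunE).
ring.
Qed.

HB.instance Definition _ := isLie.Build R cotangent
  cotangent_lieDl cotangent_lieDr cotangent_lieZl cotangent_lieZr
  cotangent_liexx cotangent_lie_jacobi.

Definition to_base (x : h) : cotangent := (x, 0).
Definition to_fibre (phi : 'Hom(h, R^o)) : cotangent := (0, phi).

Fact to_base_linear : linear to_base.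
Proof. by move=> a x y; congr pair; rewrite /= ?scaler0 ?addr0. Qed.
HB.instance Definition _ :=
  GRing.isLinear.Build R h cotangent _ to_base to_base_linear.

Fact to_fibre_linear : linear to_fibre.
Proof. by move=> a x y; congr pair; rewrite /= ?scaler0 ?addr0. Qed.
HB.instance Definition _ :=
  GRing.isLinear.Build R 'Hom(h, R^o) cotangent _ to_fibre to_fibre_linear.

Definition base : {vspace cotangent} := limg (linfun to_base).
Definition fibre : {vspace cotangent} := limg (linfun to_fibre).

End Cotangent.

Section ComplexStructure.
Variable R : fieldType.

Definition complex_structure (g : lieAlgType R) (J : 'End(g)) : Prop :=
  (J \o J)%VF = - \1%VF /\
  forall x y : g, lie (J x) (J y) - lie x y - J (lie (J x) y) - J (lie x (J y)) = 0.

Definition totally_real (h : lieAlgType R) (J : 'End(cotangent h)) : Prop :=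
  complex_structure J /\ (J @: base h)%VS = fibre h.

(* [(j^-1)%VF] is a genuine inverse only when [j] is bijective, hence the
   conjuncts on the kernel and the image. *)
Definition determines (h : lieAlgType R) (j : 'Hom(h, 'Hom(h, R^o)))
    (J : 'End(cotangent h)) : Prop :=
  [/\ lker j = 0%VS, limg j = fullv &
      forall (x : h) (phi : 'Hom(h, R^o)),
        J (x, phi) = (- (j^-1)%VF phi, j x)].

Definition dual_basis (h : vectType R) n (e : n.-tuple h) :
    n.-tuple 'Hom(h, R^o) :=
  [tuple linfun (coord e i : h -> R^o) | i < n].

(* Column [k] holds the coordinates of [j e_k], unlike [mxof], which acts on
   row vectors. *)
Definition dual_mx (h : vectType R) n (e : n.-tuple h)
    (j : 'Hom(h, 'Hom(h, R^o))) : 'M[R]_n :=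
  \matrix_(i, k) coord (dual_basis e) i (j (tnth e k)).

End ComplexStructure.

Variant lie3_name := lie_h1 | lie_r3m1 | lie_r30 | lie_r30'.

Section ThreeDim.
Variable R : fieldType.

(* Indices of basis vectors start from 1. *)
Definition e_ (k : nat) : 'rV[R]_3 := \row_(i < 3) (i.+1 == k)%:R.

(* The brackets [e_i, e_j] for i < j. *)
Definition lie3_table (t : lie3_name) (i j : nat) : 'rV[R]_3 :=
  match t, i, j with
  | lie_h1, 1, 2 => e_ 3
  | lie_r3m1, 1, 2 => e_ 2
  | lie_r3m1, 1, 3 => - e_ 3
  | lie_r30, 1, 2 => e_ 2
  | lie_r30', 1, 2 => - e_ 3
  | lie_r30', 1, 3 => e_ 2
  | _, _, _ => 0
  end.

Definition lie3 (t : lie3_name) : Type := 'rV[R]_3.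
HB.instance Definition _ t := Vector.on (lie3 t).

Definition lie3_lie t (x y : lie3 t) : lie3 t :=
  \sum_(i < 3) \sum_(j < 3 | (i < j)%N)
    (x 0 i * y 0 j - x 0 j * y 0 i) *: lie3_table t i.+1 j.+1.

Lemma lie3_lieE t (x y : lie3 t) :
  lie3_lie x y =
    (x 0 0 * y 0 1 - x 0 1 * y 0 0) *: lie3_table t 1 2
    + (x 0 0 * y 0 2%:R - x 0 2%:R * y 0 0) *: lie3_table t 1 3.
Proof.
rewrite /lie3_lie; under eq_bigr do rewrite big_mkcond.
rewrite !big_ord_recl !big_ord0 /= !(add0r, addr0).
have -> : lift ord0 ord0 = 1 :> 'I_3 by apply: val_inj.
have -> : lift ord0 (lift ord0 ord0) = 2%:R :> 'I_3 by apply: val_inj.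
by rewrite -[RHS]addr0; congr (_ + _ + _); case: t x y => * /=; rewrite scaler0.
Qed.

Fact lie3_lieDl t (x y z : lie3 t) :
  lie3_lie (x + y) z = lie3_lie x z + lie3_lie y z.
Proof. by rewrite !lie3_lieE !mxE addrACA -!scalerDl; congr (_ *: _ + _ *: _); ring. Qed.

Fact lie3_liexx t (x : lie3 t) : lie3_lie x x = 0.
Proof. by rewrite lie3_lieE !(mulrC (x 0 0)) !subrr !scale0r addr0. Qed.

Fact lie3_lieN t (x y : lie3 t) : lie3_lie y x = - lie3_lie x y.
Proof. by rewrite !lie3_lieE opprD -!scaleNr; congr (_ *: _ + _ *: _); ring. Qed.

Fact lie3_lieDr t (x y z : lie3 t) :
  lie3_lie x (y + z) = lie3_lie x y + lie3_lie x z.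
Proof. by rewrite lie3_lieN lie3_lieDl opprD -!lie3_lieN. Qed.

Fact lie3_lieZl t (a : R) (x y : lie3 t) :
  lie3_lie (a *: x) y = a *: lie3_lie x y.
Proof.
by rewrite !lie3_lieE !mxE scalerDr !scalerA; congr (_ *: _ + _ *: _); ring.
Qed.

Fact lie3_lieZr t (a : R) (x y : lie3 t) :
  lie3_lie x (a *: y) = a *: lie3_lie x y.
Proof. by rewrite lie3_lieN lie3_lieZl -scalerN -lie3_lieN. Qed.

Fact lie3_lie_jacobi t (x y z : lie3 t) :
  lie3_lie x (lie3_lie y z) + lie3_lie y (lie3_lie z x)
  + lie3_lie z (lie3_lie x y) = 0.
Proof.
rewrite !lie3_lieE; apply/rowP => -[[|[|[|m]]] i] //;
  case: t x y z => x y z; rewrite !mxE /=; ring.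
Qed.

HB.instance Definition _ t := isLie.Build R (lie3 t)
  (@lie3_lieDl t) (@lie3_lieDr t) (@lie3_lieZl t) (@lie3_lieZr t)
  (@lie3_liexx t) (@lie3_lie_jacobi t).

Definition lie3_basis t : 3.-tuple (lie3 t) := [tuple e_ i.+1 | i < 3].

Definition mx_of_rows (s : seq (seq R)) : 'M[R]_3 := \matrix_(i, k) (nth [::] s i)`_k.

Definition j_form (t : lie3_name) (A : 'M[R]_3) : Prop :=
  match t with
  | lie_h1 => exists a41 a42 a43 a51 a52 a53 : R,
      A = mx_of_rows [:: [:: a41;   a42;   a43];
                         [:: a51;   a52;   a53];
                         [:: - a43; - a53; 0]]
  | lie_r3m1 => exists a41 a42 a43 a53 : R,
      A = mx_of_rows [:: [:: a41;   a42;   a43];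
                         [:: - a42; 0;     a53];
                         [:: - a43; - a53; 0]]
  | lie_r30 => exists a41 a42 a43 a61 a63 : R,
      A = mx_of_rows [:: [:: a41;   a42;   a43];
                         [:: - a42; 0;     0];
                         [:: a61;   0;     a63]]
  | lie_r30' => exists a41 a42 a43 a53 : R,
      A = mx_of_rows [:: [:: a41;   a42;   a43];
                         [:: - a42; 0;     a53];
                         [:: - a43; - a53; 0]]
  end.

(* The Lie algebra of the group of affine maps [t |-> a t + b]; [(a, b)] stands
   for [t |-> a t + b]. *)
Definition aff : Type := (R^o * R^o)%type.
HB.instance Definition _ := Vector.on aff.
Definition aff_lie (u v : aff) : aff := (0, u.1 * v.2 - v.1 * u.2).

Lemma lie_r30_aff : exists f : {linear lie3 lie_r30 -> (R^o * aff)%type},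
  bijective f /\
  forall x y, f (lie x y) = (0, aff_lie (f x).2 (f y).2).
Proof.
pose f (x : lie3 lie_r30) : (R^o * aff)%type := (x 0 2%:R, (x 0 0, x 0 1)).
have fL : linear f by move=> a x y; rewrite /f !mxE.
pose F := HB.pack_for {linear lie3 lie_r30 -> (R^o * aff)%type} f
  (GRing.isLinear.Build R _ _ _ f fL).
pose g (u : (R^o * aff)%type) : lie3 lie_r30 :=
  \row_(i < 3) [:: u.2.1 : R; u.2.2 : R; u.1 : R]`_i.
exists F; split.
  exists g => [x | [a [b c]]].
    by apply/rowP => -[[|[|[|m]]] i] //; rewrite mxE /=;
      congr (x _ _); apply: val_inj.
  by rewrite /= /f !mxE.
move=> x y; rewrite /= /f /lie /= lie3_lieE !mxE /= /aff_lie /=.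
by congr (_, (_, _)); ring.
Qed.

End ThreeDim.

(* Main.v *)
(**
  A totally real almost complex structure J exchanges h and h^*, so it has the
  form J(x, phi) = (- j^-1 phi, j x) with j bijective.  Since h^* is abelian,
  the Nijenhuis condition on pairs from h says exactly that j is a 1-cocycle
  for the coadjoint representation, j [x, y] = ad^*(x) (j y) - ad^*(y) (j x),
  and this already implies the condition on all pairs.  With B(x, z) = (j x)(z)
  the cocycle condition reads B([x, y], z) = B(x, [y, z]) - B(y, [x, z]); on
  basis vectors it is a linear system in the entries of the matrix of j, whose
  solution space is the displayed family.  Each family contains an orthogonal
  matrix, which gives existence.
*)

Require Import Defs.
From HB Require Import structures.
From mathcomp Require Import all_boot all_order all_algebra.
From mathcomp Require Import ring lra reals.

Set Implicit Arguments.
Unset Strict Implicit.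
Unset Printing Implicit Defensive.

Import GRing.Theory Num.Theory.
Local Open Scope ring_scope.

(** * Totally real complex structures and bijective coadjoint cocycles *)

Section TotallyReal.
Variables (R : fieldType) (h : lieAlgType R).
Implicit Types (j : 'Hom(h, 'Hom(h, R^o))) (J : 'End(cotangent h)).

Definition coad_cocycle j : Prop :=
  forall x y, j (lie x y) = coad x (j y) - coad y (j x).

Lemma coadNl (x : h) p : coad (- x) p = - coad x p.
Proof. by rewrite -scaleN1r coadZl scaleN1r. Qed.

Lemma lieNl (x y : h) : lie (- x) y = - lie x y.
Proof. by rewrite lieC lieNr -lieC. Qed.

Lemma lie0l (x : h) : lie 0 x = 0.
Proof. by rewrite -[X in lie X _](scale0r (0 : h)) lieZl scale0r. Qed.

Lemma coad0l p : coad (0 : h) p = 0.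
Proof. by rewrite -[X in coad X _](scale0r (0 : h)) coadZl scale0r. Qed.

Lemma cotangent_lieE (u v : cotangent h) :
  lie u v = (lie u.1 v.1, coad u.1 v.2 - coad v.1 u.2).
Proof. by []. Qed.

Lemma memv_base (x : h) : (x, 0) \in base h.
Proof. by apply/memv_imgP; exists x; rewrite ?memvf // lfunE. Qed.

Lemma baseP (u : cotangent h) : u \in base h -> u = (u.1, 0).
Proof. by case/memv_imgP => x _ ->; rewrite lfunE. Qed.

Lemma memv_fibre phi : (0, phi) \in fibre h.
Proof. by apply/memv_imgP; exists phi; rewrite ?memvf // lfunE. Qed.

Lemma fibreP (u : cotangent h) : u \in fibre h -> u = (0, u.2).
Proof. by case/memv_imgP => x _ ->; rewrite lfunE. Qed.

Lemma bij_lfunKV j : lker j = 0%VS -> limg j = fullv ->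
  cancel j (j^-1)%VF /\ cancel (j^-1)%VF j.
Proof.
move=> jker jim; split; first by apply/lker0_lfunK/eqP.
by move=> phi; apply: limg_lfunVK; rewrite jim memvf.
Qed.

Lemma determines_totally_real j J :
  determines j J -> coad_cocycle j -> totally_real J.
Proof.
move=> [jker jim JE] jC; have [jK jVK] := bij_lfunKV jker jim.
split; first split.
- apply/lfunP => -[x phi]; rewrite comp_lfunE opp_lfunE id_lfunE !JE.
  congr pair => /=; first by rewrite jK.
  by rewrite linearN /= jVK.
- move=> [x phi] [y psi].
  (* Since [j] is onto, covectors can be written as [j p] and [j q]; this clears [j^-1] from the
     arguments of [J]. *)
  pose p := (j^-1)%VF phi; pose q := (j^-1)%VF psi.
  have [-> ->] : phi = j p /\ psi = j q by rewrite !jVK.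
  move: p q => {phi psi} p q.
  rewrite !cotangent_lieE !JE /= !jK !(lieNl, lieNr, coadNl, opprK).
  have jD a b : j (a + b) = j a + j b by exact: linearD.
  have jN a : j (- a) = - j a by exact: linearN.
  congr pair => /=.
    (* Applying the injective [j] moves the base component into the dual, where the cocycle identity
       turns all brackets into coadjoint terms that cancel. *)
    apply: (can_inj jK); rewrite linear0 !jD !jN !jVK !jC.
    by apply/lfunP => z; rewrite !(add_lfunE, opp_lfunE, zero_lfunE); ring.
  rewrite !jN !jC.
  by apply/lfunP => z; rewrite !(add_lfunE, opp_lfunE, zero_lfunE); ring.
- apply/vspaceP => u; apply/memv_imgP/idP => [[v /baseP -> ->] | /fibreP ->].
    by rewrite JE linear0 oppr0 memv_fibre.
  exists ((j^-1)%VF u.2, 0); first exact: memv_base.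
  by rewrite JE linear0 oppr0 jVK.
Qed.

Lemma totally_real_determines J :
  totally_real J -> exists2 j, determines j J & coad_cocycle j.
Proof.
move=> [[JJ JN] Jim].
have JJE u : J (J u) = - u.
  by move/lfunP: JJ => /(_ u); rewrite comp_lfunE opp_lfunE id_lfunE.
(* [J (x, 0)] lies in the fibre, so its second component determines it. *)
pose f (x : h) : 'Hom(h, R^o) := (J (x, 0)).2.
have fL : linear f.
  move=> a x y; rewrite /f -[(a *: x + y, 0)]/(to_base (a *: x + y)).
  by rewrite !linearP.
pose F := HB.pack_for {linear h -> 'Hom(h, R^o)} f
  (GRing.isLinear.Build R _ _ _ f fL).
pose j := linfun F.
have Jb x : J (x, 0) = (0, j x).
  rewrite lfunE; apply/fibreP; rewrite -Jim; apply: memv_img; exact: memv_base.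
have jsurj phi : exists x, j x = phi.
  have := memv_fibre phi; rewrite -Jim => /memv_imgP[v /baseP ->].
  by rewrite Jb => -[->]; exists v.1.
(* [J^2 = -1] determines [J] on the fibre from its values on the base, and also yields injectivity
   of [j]. *)
have Jf x : J (0, j x) = (- x, 0) by rewrite -Jb JJE; congr pair; rewrite oppr0.
have jker : lker j = 0%VS.
  apply/eqP/lker0P => x y; have := Jf x; have := Jf y => + + E.
  by rewrite -E => -> [] /oppr_inj.
have jim : limg j = fullv.
  apply/vspaceP => phi; rewrite memvf; have [x <-] := jsurj phi.
  by rewrite memv_img ?memvf.
have [jK jVK] := bij_lfunKV jker jim.
have JE x phi : J (x, phi) = (- (j^-1)%VF phi, j x).
  have E : (x, phi) = (x, 0) + (0, j ((j^-1)%VF phi)) :> cotangent h.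
    by rewrite jVK; congr pair; rewrite ?addr0 ?add0r.
  rewrite [in LHS]E; apply: etrans (linearD J _ _) _.
  apply: etrans (congr2 +%R (Jb x) (Jf _)) _.
  by congr pair; rewrite /= ?addr0 ?add0r.
exists j => // x y.
have := JN (x, 0) (y, 0).
(* The fibre is abelian, so the base component is [- [x, y]] plus [j^-1] of the two coadjoint terms;
   applying [j] gives the cocycle identity. *)
rewrite !Jb !cotangent_lieE /= !JE => /(congr1 fst) /= /(congr1 j).
have jD a b : j (a + b) = j a + j b by exact: linearD.
have jN a : j (- a) = - j a by exact: linearN.
rewrite lie0l !coad0l subr0 !sub0r !jD !jN !jVK !linear0 => /lfunP E.
apply/lfunP => z; move: (E z).
rewrite !(add_lfunE, opp_lfunE, zero_lfunE) => Ez.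
by apply: subr0_eq; rewrite -[RHS]oppr0 -Ez; ring.
Qed.

Lemma determines_exists j : lker j = 0%VS -> limg j = fullv ->
  exists J, determines j J.
Proof.
move=> jker jim.
pose f (u : cotangent h) : cotangent h := (- (j^-1)%VF u.2, j u.1).
have fL : linear f.
  by move=> a u v; congr pair; rewrite /= linearP // opprD scalerN.
pose F := HB.pack_for {linear cotangent h -> cotangent h} f
  (GRing.isLinear.Build R _ _ _ f fL).
by exists (linfun F); split=> // x phi; rewrite lfunE.
Qed.

End TotallyReal.

(** * Matrices of maps into the dual space *)

Section DualMatrix.
Variables (R : fieldType) (h : vectType R) (n : nat) (e : n.-tuple h).
Hypothesis eB : basis_of fullv e.
Implicit Types (j : 'Hom(h, 'Hom(h, R^o))).

Lemma dual_basisE (i : 'I_n) (x : h) : (dual_basis e)`_i x = coord e i x.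
Proof. by rewrite -tnth_nth tnth_mktuple lfunE. Qed.

Lemma dual_basis_sum (phi : 'Hom(h, R^o)) :
  phi = \sum_(i < n) phi e`_i *: (dual_basis e)`_i.
Proof.
apply/lfunP => x; rewrite sum_lfunE {1}(coord_basis eB (memvf x)) linear_sum.
by apply: eq_bigr => i _; rewrite scale_lfunE linearZ dual_basisE [LHS]mulrC.
Qed.

Lemma free_dual_basis : free (dual_basis e).
Proof.
apply/freeP => a /lfunP a0 i; have := a0 e`_i.
have eF := basis_free eB.
rewrite sum_lfunE zero_lfunE (bigD1 i) //= big1 => [|k ki].
  rewrite scale_lfunE dual_basisE coord_free // eqxx addr0 => <-.
  by rewrite [RHS]mulr1.
by rewrite scale_lfunE dual_basisE coord_free // eq_sym (negPf ki) scaler0.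
Qed.

Lemma dual_mxE j (i k : 'I_n) : dual_mx e j i k = j e`_k e`_i.
Proof.
rewrite mxE [j _]dual_basis_sum coord_sum_free ?free_dual_basis //.
by rewrite (tnth_nth 0).
Qed.

(** Bridges the column convention of [dual_mx] and the row vectors of the matrix kernel lemmas,
    hence the transpose. *)
Lemma mul_dual_mx_tr j (v : 'rV[R]_n) :
  v *m (dual_mx e j)^T = \row_i j (\sum_k v 0 k *: e`_k) e`_i.
Proof.
apply/rowP => i; rewrite !mxE linear_sum sum_lfunE.
by apply: eq_bigr => k _; rewrite mxE dual_mxE linearZ scale_lfunE.
Qed.

(** Row vectors killed by the transposed matrix are exactly the coordinates of kernel vectors of
    [j]. *)
Lemma dual_mx_unit j : (dual_mx e j \in unitmx) = (lker j == 0%VS).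
Proof.
rewrite -unitmx_tr; apply/idP/lker0P => [Au | jI].
  move=> x y /eqP; rewrite -subr_eq0 -linearB => /eqP jxy.
  apply: subr0_eq; rewrite (coord_basis eB (memvf (x - y))).
  apply: big1 => k _; pose v := \row_k coord e k (x - y).
  suff /rowP/(_ k) : v = 0 by rewrite !mxE => ->; rewrite scale0r.
  apply: (can_inj (mulmxK Au)); rewrite mul0mx mul_dual_mx_tr.
  apply/rowP => i; rewrite !mxE.
  under eq_bigr => l _ do rewrite mxE.
  by rewrite -(coord_basis eB (memvf _)) jxy zero_lfunE.
rewrite -row_free_unit -kermx_eq0; apply/rowV0P => v.
move=> /sub_kermxP; rewrite mul_dual_mx_tr => jv0.
suff s0 : \sum_k v 0 k *: e`_k = 0.
  by apply/rowP => k; rewrite mxE; move/freeP: (basis_free eB); apply.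
apply: jI; rewrite linear0 [LHS]dual_basis_sum big1 // => i _.
by move/rowP/(_ i): jv0; rewrite !mxE => ->; rewrite scale0r.
Qed.

(** The space and its dual have the same dimension. *)
Lemma lker0_limg_full j : lker j = 0%VS -> limg j = fullv.
Proof.
move=> jker; apply/eqP; rewrite eqEdim subvf limg_dim_eq ?jker ?capv0 //.
by rewrite !dimvf /dim /= muln1.
Qed.

Lemma dual_mx_surj (A : 'M[R]_n) : exists j, dual_mx e j = A.
Proof.
pose f x := \sum_i (\sum_k A i k * coord e k x) *: (dual_basis e)`_i.
have fL : linear f.
  move=> a x y; rewrite /f scaler_sumr -big_split; apply: eq_bigr => i _ /=.
  rewrite scalerA -scalerDl mulr_sumr -big_split; congr (_ *: _).
  by apply: eq_bigr => k _; rewrite /= linearP mulrDr mulrCA.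
pose F := HB.pack_for {linear h -> 'Hom(h, R^o)} f
  (GRing.isLinear.Build R _ _ _ f fL).
exists (linfun F); apply/matrixP => i k.
rewrite mxE lfunE /= coord_sum_free ?free_dual_basis // (tnth_nth 0).
rewrite (bigD1 k) //= coord_free ?(basis_free eB) // eqxx mulr1.
rewrite big1 ?addr0 // => l lk.
by rewrite coord_free ?(basis_free eB) // eq_sym (negPf lk) mulr0.
Qed.

End DualMatrix.

(** * Bilinear forms and basis brackets in dimension three *)

Section ThreeDimensional.
Variables (R : realFieldType) (t : lie3_name).
Local Notation h := (lie3 R t).
Local Notation e := (lie3_basis R t).
Implicit Types (j : 'Hom(h, 'Hom(h, R^o))) (A : 'M[R]_3).

Lemma ord3P (P : 'I_3 -> Prop) : P 0 -> P 1 -> P 2%:R -> forall i, P i.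
Proof.
by move=> P0 P1 P2 -[[|[|[|m]]] i] //; [move: P0 | move: P1 | move: P2];
  congr P; apply: val_inj.
Qed.

Lemma sum_ord3 (V : zmodType) (F : 'I_3 -> V) :
  \sum_(i < 3) F i = F 0 + F 1 + F 2%:R.
Proof.
rewrite !big_ord_recl big_ord0 addr0 addrA.
by congr (_ + F _ + F _); apply: val_inj.
Qed.

Lemma lie3_basis_sum (x : h) : x = \sum_k x 0 k *: e`_k.
Proof.
rewrite sum_ord3 -!(tnth_nth 0 e) !tnth_mktuple.
apply/rowP; apply: ord3P; rewrite !mxE /=; ring.
Qed.

Lemma lie3_basisP : basis_of fullv e.
Proof.
rewrite basisEdim size_tuple dimvf /dim /= leqnn andbT.
apply/subvP => x _; rewrite [x]lie3_basis_sum.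
by apply: memv_suml => k _; rewrite memvZ // memv_span // mem_nth ?size_tuple.
Qed.

Lemma lie3_formE j (x y : h) : let A := dual_mx e j in
  j x y = x 0 0 * (A 0 0 * y 0 0 + A 1 0 * y 0 1 + A 2%:R 0 * y 0 2%:R)
   + x 0 1 * (A 0 1 * y 0 0 + A 1 1 * y 0 1 + A 2%:R 1 * y 0 2%:R)
   + x 0 2%:R * (A 0 2%:R * y 0 0 + A 1 2%:R * y 0 1 + A 2%:R 2%:R * y 0 2%:R).
Proof.
move=> A; rewrite {1}[x]lie3_basis_sum {1}[y]lie3_basis_sum.
rewrite (linear_sum j) sum_lfunE sum_ord3.
have jE k : (j (x 0 k *: e`_k)) (\sum_i y 0 i *: e`_i) =
  x 0 k * (A 0 k * y 0 0 + A 1 k * y 0 1 + A 2%:R k * y 0 2%:R).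
  rewrite linearZ scale_lfunE linear_sum sum_ord3 !linearZ.
  rewrite /A !(dual_mxE lie3_basisP).
  by congr (_ * (_ + _ + _)); apply: mulrC.
by rewrite !jE.
Qed.

(** Evaluation at [z]: the sign in [coad] swaps the order of the two terms on the right. *)
Lemma coad_cocycleP j : coad_cocycle j <->
  forall x y z : h, j (lie x y) z = j x (lie y z) - j y (lie x z).
Proof.
split=> [jC x y z | jC x y].
  by rewrite jC add_lfunE opp_lfunE !coadE opprK addrC.
by apply/lfunP => z; rewrite add_lfunE opp_lfunE !coadE opprK addrC.
Qed.

Lemma dual_mx_lie3 j (b := fun k i : nat => j (e_ R k) (e_ R i)) :
  dual_mx e j = mx_of_rows [:: [:: b 1 1; b 2 1; b 3 1];
                               [:: b 1 2; b 2 2; b 3 2];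
                               [:: b 1 3; b 2 3; b 3 3]]%N.
Proof.
apply/matrixP; do 2!apply: ord3P;
  by rewrite (dual_mxE lie3_basisP) [RHS]mxE -!(tnth_nth 0 e) !tnth_mktuple.
Qed.

Lemma lie3_e12 : lie (e_ R 1 : h) (e_ R 2) = lie3_table R t 1 2.
Proof.
rewrite [LHS]lie3_lieE !mxE /= !(mulr0, mul0r, mulr1, subr0).
by rewrite scale1r scale0r addr0.
Qed.

Lemma lie3_e13 : lie (e_ R 1 : h) (e_ R 3) = lie3_table R t 1 3.
Proof.
rewrite [LHS]lie3_lieE !mxE /= !(mulr0, mul0r, mulr1, subr0).
by rewrite scale1r scale0r add0r.
Qed.

Lemma lie3_e23 : lie (e_ R 2 : h) (e_ R 3) = 0.
Proof.
rewrite [LHS]lie3_lieE !mxE /= !(mulr0, mul0r, mulr1, subr0).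
by rewrite !scale0r addr0.
Qed.

End ThreeDimensional.

(** * Solving the cocycle equations *)

Section Cocycle.
Variables (R : realFieldType) (t : lie3_name).
Implicit Types (j : 'Hom(lie3 R t, 'Hom(lie3 R t, R^o))).

Lemma coad_cocycle_j_form j :
  coad_cocycle j -> j_form t (dual_mx (lie3_basis R t) j).
Proof.
move=> /coad_cocycleP jC.
have E21 : lie (e_ R 2 : lie3 R t) (e_ R 1) = - lie3_table R t 1 2.
  by rewrite lieC lie3_e12.
have E31 : lie (e_ R 3 : lie3 R t) (e_ R 1) = - lie3_table R t 1 3.
  by rewrite lieC lie3_e13.
have E32 : lie (e_ R 3 : lie3 R t) (e_ R 2) = 0 by rewrite lieC lie3_e23 oppr0.
have jNl x y : j (- x) y = - j x y by rewrite linearN opp_lfunE.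
have jNr x y : j x (- y) = - j x y by rewrite linearN.
have j0l y : j 0 y = 0 by rewrite linear0 zero_lfunE.
have j0r x : j x 0 = 0 by rewrite linear0.
have H a b c : _ := jC (e_ R a) (e_ R b) (e_ R c).
(* By antisymmetry in the first two arguments nine triples suffice; (2,3,2) and (2,3,3) read [0 = 0]
   because [[e_2, e_3] = 0]. *)
move: (H 1 2 1)%N (H 1 2 2)%N (H 1 2 3)%N (H 1 3 1)%N (H 1 3 2)%N (H 1 3 3)%N
   (H 2 3 1)%N.
rewrite !(liexx, lie3_e12, lie3_e13, lie3_e23, E21, E31, E32, j0l, j0r, jNr).
rewrite dual_mx_lie3 => {jC H E21 E31 E32}.
(* [bki] is the value on [(e_k, e_i)], the entry in row [i] and column [k], so the first row is
   always [b11, b21, b31]. The vanishing of [b22] comes from [2 * b22 = 0] for [lie_r3m1] and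
   [lie_r30]; for [lie_r30'], triple (1,2,3) gives [b22 = b33] and (2,3,1) gives [b22 = - b33]. *)
case: t j jNl jNr j0l j0r => j jNl jNr j0l j0r /=;
  rewrite ?(jNl, jNr, j0l, j0r, opprK) => {jNl jNr j0l j0r};
  move: (j (e_ R 1) (e_ R 1)) (j (e_ R 1) (e_ R 2)) (j (e_ R 1) (e_ R 3))
        (j (e_ R 2) (e_ R 1)) (j (e_ R 2) (e_ R 2)) (j (e_ R 2) (e_ R 3))
        (j (e_ R 3) (e_ R 1)) (j (e_ R 3) (e_ R 2)) (j (e_ R 3) (e_ R 3))
  => b11 b12 b13 b21 b22 b23 b31 b32 b33 ? ? ? ? ? ? ?; exists b11, b21, b31.
- by exists b12, b22, b32; congr (mx_of_rows [:: _; _; [:: _; _; _]]); lra.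
- by exists b32; congr (mx_of_rows [:: _; [:: _; _; _]; [:: _; _; _]]); lra.
- by exists b13, b33; congr (mx_of_rows [:: _; [:: _; _; _]; [:: _; _; _]]); lra.
- by exists b32; congr (mx_of_rows [:: _; [:: _; _; _]; [:: _; _; _]]); lra.
Qed.

(** In coordinates the cocycle condition becomes, for each algebra, a polynomial identity in the
    vectors' coordinates and the free matrix entries. *)
Lemma j_form_coad_cocycle j :
  j_form t (dual_mx (lie3_basis R t) j) -> coad_cocycle j.
Proof.
move=> jA; apply/coad_cocycleP => x y z; move: jA.
rewrite !lie3_formE; move: (dual_mx _ _) => A.
have lieE (u v : lie3 R t) (i : 'I_3) : lie u v 0 i =
    (u 0 0 * v 0 1 - u 0 1 * v 0 0) * lie3_table R t 1 2 0 i
    + (u 0 0 * v 0 2%:R - u 0 2%:R * v 0 0) * lie3_table R t 1 3 0 i.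
  by rewrite [lie u v]lie3_lieE !mxE.
rewrite !lieE => {lieE}.
move: (x 0 0) (x 0 1) (x 0 2%:R) (y 0 0) (y 0 1) (y 0 2%:R)
      (z 0 0) (z 0 1) (z 0 2%:R)
  => x0 x1 x2 y0 y1 y2 z0 z1 z2.
case: t => /= -[a [b [c]]] => [[d [f [g ->]]] | [d ->] | [d [f ->]] | [d ->]];
  by rewrite !mxE /=; ring.
Qed.

End Cocycle.

(** * Existence and the classification *)

Lemma j_form_unit (R : realFieldType) (t : lie3_name) :
  exists2 A : 'M[R]_3, A \in unitmx & j_form t A.
Proof.
(* Signed permutation matrices, hence orthogonal. The entries [- 0] keep the literal shape of
   [j_form]; [P2] serves both [lie_r3m1] and [lie_r30'], whose forms coincide. *)
pose P1 : 'M[R]_3 := mx_of_rows [:: [:: 0; 0; 1]; [:: 0; 1; 0]; [:: - 1; - 0; 0]].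
pose P2 : 'M[R]_3 := mx_of_rows [:: [:: 1; 0; 0]; [:: - 0; 0; 1]; [:: - 0; - 1; 0]].
pose P3 : 'M[R]_3 := mx_of_rows [:: [:: 0; 1; 0]; [:: - 1; 0; 0]; [:: 0; 0; 1]].
have unit (A : 'M[R]_3) : A *m A^T = 1%:M -> A \in unitmx by case/mulmx1_unit.
have [U1 U2 U3] : [/\ P1 \in unitmx, P2 \in unitmx & P3 \in unitmx].
  split; apply: unit; apply/matrixP; do 2!apply: ord3P;
    rewrite !mxE sum_ord3 !mxE /=; ring.
case: t; [exists P1 | exists P2 | exists P3 | exists P2] => //=.
- by exists 0, 0, 1, 0, 1, 0.
- by exists 1, 0, 0, 1.
- by exists 0, 1, 0, 0, 1.
- by exists 1, 0, 0, 1.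
Qed.

Theorem proposition3p8 (R : realType) (t : lie3_name) :
  (exists J : 'End(cotangent (lie3 R t)), totally_real J) /\
  (forall J : 'End(cotangent (lie3 R t)),
     totally_real J <->
     exists j : 'Hom(lie3 R t, 'Hom(lie3 R t, R^o)),
       [/\ determines j J,
           dual_mx (lie3_basis R t) j \in unitmx &
           j_form t (dual_mx (lie3_basis R t) j)]).
Proof.
have eB := lie3_basisP R t; split=> [|J].
  have [A Au At] := j_form_unit R t; have [j jA] := dual_mx_surj eB A.
  have jker : lker j = 0%VS by apply/eqP; rewrite -(dual_mx_unit eB) jA.
  have [J jJ] := determines_exists jker (lker0_limg_full jker).
  exists J; apply: determines_totally_real jJ _.
  by apply: j_form_coad_cocycle; rewrite jA.
split=> [/totally_real_determines[j jJ jC] | [j [jJ _ jt]]].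
  exists j; split=> //; last exact: coad_cocycle_j_form.
  by rewrite (dual_mx_unit eB); case: jJ => ->.
exact/(determines_totally_real jJ)/j_form_coad_cocycle.
Qed.
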